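(* Let $\gamma\in(1,3)$, $\rho_\infty>0$, $\mathsf T>0$, and suppose that $(\rho,u)$, $s$ is a solution of the piston problem (see context) up to time $\mathsf T$ whose flow field is smooth with $\rho>0$ in $\Omega_{\mathsf T}$. Then on the shock front $\mathsf S\cap\{t<\mathsf T\}$, $$\partial^+c+k_g\,\partial^-c=0,$$ where $$k_g=\left.\frac{\sqrt\gamma\,(k-1)k^{\frac{\gamma-1}2}-f(k)}{f(k)+\sqrt\gamma\,(k-1)k^{\frac{\gamma-1}2}}\cdot\frac{\frac1{\sqrt\gamma}f'(k)k^{\frac{3-\gamma}2}-1}{\frac1{\sqrt\gamma}f'(k)k^{\frac{3-\gamma}2}+1}\right|_{k=\mathsf k(t)},\qquad f'(k)=\frac{\gamma k^{\gamma+1}+(1-\gamma)k^\gamma-1}{2k^2f(k)} .$$ Furthermore, suppose (for a family of such solutions indexed by $\rho_\infty$) that $\lim_{\rho_\infty\to0+}\mathsf k(t)=+\infty$, the limit being uniform with respect to $t$. Then $$1-k_g\sim\frac6{\sqrt\gamma}\,(\mathsf k(t))^{-\frac12} .$$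
   Context: Piston problem: $x=w(t)$ is the piston trajectory, $\mathsf S=\{(x,t):x=s(t),\,t>0\}$ is the leading shock front, $w(0)=s(0)=0$, $s(t)>w(t)$ for $t>0$, and $\Omega_{\mathsf T}=\{(x,t):0<t<\mathsf T,\ w(t)\le x\le s(t)\}$. The density $\rho$ and velocity $u$ satisfy $\rho_t+(\rho u)_x=0$, $(\rho u)_t+(\rho u^2+\rho^\gamma)_x=0$ in $\Omega_{\mathsf T}$; $u(w(t),t)=w'(t)$; and on $\mathsf S$ (with values being limits from $x<s(t)$) the Rankine–Hugoniot and entropy conditions $(\rho-\rho_\infty)s'(t)=\rho u$, $\rho u\,s'(t)=\rho u^2+\rho^\gamma-\rho_\infty^\gamma$, $\rho>\rho_\infty$, with $u>0$ and $s'>0$ there (advancing piston). Notation: $c=\sqrt\gamma\,\rho^{\frac{\gamma-1}2}$, $\lambda_\pm=u\pm c$, $\partial^\pm=\partial_t+\lambda_\pm\partial_x$; $\mathsf k(t)=\rho(s(t),t)/\rho_\infty>1$; $f(k)=\sqrt{(1-\frac1k)(k^\gamma-1)}$ for $k>1$. For positive quantities $\mathcal F,\mathcal G$ depending on $\rho_\infty$ and possibly on $(x,t)$, $\mathcal F\sim\mathcal G$ means $\lim_{\rho_\infty\to0+}\mathcal F=\lim_{\rho_\infty\to0+}\mathcal G=0$ and $\lim_{\rho_\infty\to0+}\mathcal F/\mathcal G=1$, with limits uniform in $(x,t)$. *)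

(* Defs.v *)
From Stdlib Require Import Reals ClassicalEpsilon.
From Coquelicot Require Import Coquelicot.
Open Scope R_scope.

(** Points of the plane are pairs [(x, t)] : position first, time second. *)

(** Derivatives at points of a set [D] that need not be open, as limits from
    inside [D].  [grad] is the (partial x, partial t) gradient of [f]; like
    Coquelicot's [Derive] it is a junk value when [f] is not differentiable.
    The region of the piston problem contains a cone at each of its points,
    boundary points included, so the gradient is unique there. *)
Definition is_grad (D : R * R -> Prop) (f : R * R -> R) (p g : R * R) : Prop :=
  filterdiff f (within D (locally p))
    (fun v : R * R => fst g * fst v + snd g * snd v).

Definition grad (D : R * R -> Prop) (f : R * R -> R) (p : R * R) : R * R :=
  epsilon (inhabits (0, 0)) (is_grad D f p).

Definition Dx (D : R * R -> Prop) (f : R * R -> R) (p : R * R) : R :=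
  fst (grad D f p).

Definition Dt (D : R * R -> Prop) (f : R * R -> R) (p : R * R) : R :=
  snd (grad D f p).

Definition C1_on (D : R * R -> Prop) (f : R * R -> R) : Prop :=
  (forall p, D p -> exists g, is_grad D f p g) /\
  continuous_on D (Dx D f) /\ continuous_on D (Dt D f).

Definition Omega (T : R) (w s : R -> R) (p : R * R) : Prop :=
  0 < snd p < T /\ w (snd p) <= fst p <= s (snd p).

(** [rho] and [u] matter only on [Omega T w s]; their values on the front
    [(s t, t)] are the limits from behind the shock, by continuity. *)
Record piston_solution (gamma rho_inf T : R) (w s : R -> R)
    (rho u : R * R -> R) : Prop := {
  ps_w0 : w 0 = 0;
  ps_s0 : s 0 = 0;
  ps_w_lt_s : forall t, 0 < t < T -> w t < s t;
  ps_rho_C1 : C1_on (Omega T w s) rho;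
  ps_u_C1 : C1_on (Omega T w s) u;
  ps_rho_gt0 : forall p, Omega T w s p -> 0 < rho p;
  ps_mass : forall p, Omega T w s p ->
    Dt (Omega T w s) rho p
    + Dx (Omega T w s) (fun q => rho q * u q) p = 0;
  ps_momentum : forall p, Omega T w s p ->
    Dt (Omega T w s) (fun q => rho q * u q) p
    + Dx (Omega T w s) (fun q => rho q * u q ^ 2 + Rpower (rho q) gamma) p = 0;
  ps_piston : forall t, 0 < t < T -> is_derive w t (u (w t, t));
  ps_s_derive : forall t, 0 < t < T -> ex_derive s t;
  ps_RH_mass : forall t, 0 < t < T ->
    (rho (s t, t) - rho_inf) * Derive s t = rho (s t, t) * u (s t, t);
  ps_RH_momentum : forall t, 0 < t < T ->
    rho (s t, t) * u (s t, t) * Derive s t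
    = rho (s t, t) * u (s t, t) ^ 2
      + Rpower (rho (s t, t)) gamma - Rpower rho_inf gamma;
  ps_entropy : forall t, 0 < t < T -> rho_inf < rho (s t, t);
  ps_u_gt0 : forall t, 0 < t < T -> 0 < u (s t, t);
  ps_s'_gt0 : forall t, 0 < t < T -> 0 < Derive s t
}.

Definition sound_speed (gamma : R) (rho : R * R -> R) (p : R * R) : R :=
  sqrt gamma * Rpower (rho p) ((gamma - 1) / 2).

Definition lambda_plus (gamma : R) (rho u : R * R -> R) (p : R * R) : R :=
  u p + sound_speed gamma rho p.

Definition lambda_minus (gamma : R) (rho u : R * R -> R) (p : R * R) : R :=
  u p - sound_speed gamma rho p.

Definition d_plus (gamma : R) (D : R * R -> Prop) (rho u h : R * R -> R)
    (p : R * R) : R :=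
  Dt D h p + lambda_plus gamma rho u p * Dx D h p.

Definition d_minus (gamma : R) (D : R * R -> Prop) (rho u h : R * R -> R)
    (p : R * R) : R :=
  Dt D h p + lambda_minus gamma rho u p * Dx D h p.

Definition front_ratio (rho_inf : R) (s : R -> R) (rho : R * R -> R)
    (t : R) : R :=
  rho (s t, t) / rho_inf.

Definition f_shock (gamma k : R) : R :=
  sqrt ((1 - 1 / k) * (Rpower k gamma - 1)).

Definition k_g (gamma k : R) : R :=
  (sqrt gamma * (k - 1) * Rpower k ((gamma - 1) / 2) - f_shock gamma k)
  / (f_shock gamma k + sqrt gamma * (k - 1) * Rpower k ((gamma - 1) / 2))
  * ((1 / sqrt gamma * Derive (f_shock gamma) k * Rpower k ((3 - gamma) / 2) - 1)
     / (1 / sqrt gamma * Derive (f_shock gamma) k * Rpower k ((3 - gamma) / 2) + 1)).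

(** Limits as [r -> 0+] of families [F r a], uniform over the [a] with
    [D r a]. *)
Definition unif_lim {A : Type} (D : R -> A -> Prop) (F : R -> A -> R) (l : R)
    : Prop :=
  forall eps : posreal,
    at_right 0 (fun r => forall a, D r a -> Rabs (F r a - l) < eps).

Definition unif_lim_p_infty {A : Type} (D : R -> A -> Prop) (F : R -> A -> R)
    : Prop :=
  forall M : R, at_right 0 (fun r => forall a, D r a -> M < F r a).

Definition asymp_equiv {A : Type} (D : R -> A -> Prop) (F G : R -> A -> R)
    : Prop :=
  at_right 0 (fun r => forall a, D r a -> 0 < F r a /\ 0 < G r a) /\
  unif_lim D F 0 /\ unif_lim D G 0 /\
  unif_lim D (fun r a => F r a / G r a) 1.

(* Main.v *)
Require Import Defs.
From Stdlib Require Import Reals Lra ClassicalEpsilon.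
From Coquelicot Require Import Coquelicot.
Open Scope R_scope.

(** The Rankine-Hugoniot conditions determine [u = rho_inf^((gamma-1)/2) f(k)]
    on the front.  Differentiating this along the front and eliminating the
    time derivatives with the Euler equations leaves one linear relation
    between [rho_x] and [u_x], which is the relation between the two
    characteristic derivatives of [c].  The front has a tangent and a
    horizontal chord inside the region at each of its points, so gradients
    there are unique and obey the usual calculus.  For the asymptotics, the
    factors of [k_g] are [(1 - a) / (1 + a)] and [(1 - b) / (1 + b)], where
    [a] and [b] are of the order of [k^(-1/2)] with coefficients
    [1 / sqrt gamma] and [2 / sqrt gamma], and
    [1 - k_g = 2 (a + b) / ((1 + a) (1 + b))]. *)

(** * Differentiation within a set and along curves *)

Lemma within_proper {T : UniformSpace} (D : T -> Prop) (p : T) :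
  D p -> ProperFilter (within D (locally p)).
Proof.
intros Dp; constructor.
- intros P HP; exists p; exact (locally_singleton p _ HP Dp).
- apply within_filter, locally_filter.
Qed.

Lemma within_filter_lim {T : UniformSpace} (D : T -> Prop) (p : T) :
  is_filter_lim (within D (locally p)) p.
Proof. exact (filter_le_within (F := locally p) D). Qed.

(** [filterdiff] asks for the estimate at every limit of its filter. Properness of [G] makes limits
    unique, and [G] inherits the limit [p] from [F], so only the estimate at [p] is needed and [F]
    supplies it. *)
Lemma filterdiff_filter_le {U V : NormedModule R_AbsRing}
    (F G : (U -> Prop) -> Prop) (f l : U -> V) (p : U) :
  ProperFilter G -> is_filter_lim F p -> filter_le G F ->
  filterdiff f F l -> filterdiff f G l.
Proof.
intros HG Fp GF [Hl Hd]; split; [exact Hl|].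
intros y Gy.
assert (E : p = y).
{ refine (is_filter_lim_unique (F := G) p y _ Gy).
  intros P HP; apply GF, Fp, HP. }
subst y.
apply (is_domin_le (F := F)); [apply Hd, Fp|exact GF].
Qed.

(** Subtracting the two expansions makes [(m - m') * (y - x)] negligible against [y - x], which is
    absurd at a point [y <> x] when the tolerance is [Rabs (m - m') / 2]. The filter may be
    one-sided. *)
Lemma filterdiff_slope_unique (F : (R -> Prop) -> Prop) (f : R -> R)
    (x m m' : R) :
  ProperFilter F -> is_filter_lim F x -> F (fun y => y <> x) ->
  filterdiff f F (fun h => h * m) -> filterdiff f F (fun h => h * m') ->
  m = m'.
Proof.
intros HF Fx Hne H1 H2.
destruct (Req_dec m m') as [E|E]; [exact E|exfalso].
pose proof (filterdiff_minus_fct f f _ _ H1 H2) as [_ Hd].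
assert (He : 0 < Rabs (m - m') / 2).
{ assert (0 < Rabs (m - m')) by (apply Rabs_pos_lt; lra); lra. }
specialize (Hd x Fx (mkposreal _ He)).
destruct (filter_ex _ (filter_and _ _ Hne Hd)) as [y [Hy H]].
unfold minus, plus, opp, norm in H; simpl in H; unfold abs in H; simpl in H.
replace (f y + - f y + - (f x + - f x)
  + - ((y + - x) * m + - ((y + - x) * m')))
  with (- ((m - m') * (y + - x))) in H by ring.
rewrite Rabs_Ropp, Rabs_mult in H.
assert (0 < Rabs (y + - x)) by (apply Rabs_pos_lt; lra).
nra.
Qed.

Lemma is_grad_continuous (D : R * R -> Prop) (f : R * R -> R) (p g : R * R) :
  is_grad D f p g -> filterlim f (within D (locally p)) (locally (f p)).
Proof.
intros Hg.
refine (filterdiff_continuous_aux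
  (U := prod_NormedModule _ R_NormedModule R_NormedModule)
  (V := R_NormedModule) f _ p (within_filter_lim D p)).
eexists; exact Hg.
Qed.

(** A curve that is continuous and stays in [D] pushes [F] to a filter finer than the one defining
    the gradient, so the chain rule applies. Leaving [F] general covers both the two-sided front and
    the one-sided horizontal chord. *)
Lemma is_grad_along (D : R * R -> Prop) (f : R * R -> R) (g v : R * R)
    (c : R -> R * R) (x : R) (F : (R -> Prop) -> Prop) :
  ProperFilter F -> is_filter_lim F x -> F (fun y => D (c y)) ->
  filterdiff c F (fun h => (h * fst v, h * snd v)) ->
  is_grad D f (c x) g ->
  filterdiff (fun y => f (c y)) F
    (fun h => h * (fst g * fst v + snd g * snd v)).
Proof.
intros HF Fx HD Hc Hg.
apply (filterdiff_ext_lin _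
  (fun h : R => fst g * (h * fst v) + snd g * (h * snd v))); [|intros; cbn; ring].
refine (filterdiff_comp c f _ (fun w : R * R => fst g * fst w + snd g * snd w)
          Hc _).
refine (filterdiff_filter_le _ _ _ _ (c x) (filtermap_proper_filter _ _ _ _ HF)
          (within_filter_lim D (c x)) _ Hg).
{ intros P HP.
  assert (Hcont : filterlim c F (locally (c x))).
  { refine (filterdiff_continuous_aux (U := R_NormedModule)
      (V := prod_NormedModule _ R_NormedModule R_NormedModule) c _ x Fx).
    eexists; exact Hc. }
  generalize (filter_and _ _ HD (Hcont _ HP)).
  apply filter_imp; intros y [A B]; exact (B A). }
Qed.

Lemma is_grad_comp (D : R * R -> Prop) (f : R * R -> R) (p g : R * R)
    (phi : R -> R) (l : R) :
  D p -> is_grad D f p g -> is_derive phi (f p) l ->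
  is_grad D (fun q => phi (f q)) p (l * fst g, l * snd g).
Proof.
intros Dp Hg Hphi; unfold is_grad.
pose proof (within_proper D p Dp) as HF.
apply (filterdiff_ext_lin _
  (fun v : R * R => scal (fst g * fst v + snd g * snd v) l)).
2: { intros; unfold scal; simpl; unfold mult; simpl; ring. }
refine (filterdiff_comp f phi _ (fun y : R => scal y l) Hg _).
apply (filterdiff_locally _ (f p)); [|exact Hphi].
exact (is_grad_continuous D f p g Hg).
Qed.

Lemma is_grad_mult (D : R * R -> Prop) (f h : R * R -> R) (p g k : R * R) :
  D p -> is_grad D f p g -> is_grad D h p k ->
  is_grad D (fun q => f q * h q) p
    (fst g * h p + f p * fst k, snd g * h p + f p * snd k).
Proof.
intros Dp Hf Hh; unfold is_grad.
pose proof (within_proper D p Dp) as HF.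
pose proof (is_grad_continuous _ _ _ _ Hf) as Cf.
pose proof (is_grad_continuous _ _ _ _ Hh) as Ch.
apply (filterdiff_ext_lin _
  (fun v : R * R => (fst g * fst v + snd g * snd v) * h p
                    + f p * (fst k * fst v + snd k * snd v))).
2: intros; simpl; ring.
refine (filterdiff_comp_2 f h (fun a b : R => a * b) _ _
  (fun a b : R => a * h p + f p * b) Hf Hh _).
refine (filterdiff_mult (K := R_AbsRing) (f p, h p) _ Rmult_comm).
intros P [e He].
unfold filtermap; generalize (filter_and _ _ (proj1 (filterlim_locally f _) Cf e)
  (proj1 (filterlim_locally h _) Ch e)).
apply filter_imp; intros q [A B]; apply He; split; assumption.
Qed.

Lemma is_grad_plus (D : R * R -> Prop) (f h : R * R -> R) (p g k : R * R) :
  is_grad D f p g -> is_grad D h p k ->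
  is_grad D (fun q => f q + h q) p (fst g + fst k, snd g + snd k).
Proof.
intros Hf Hh; unfold is_grad.
apply (filterdiff_ext_lin _
  (fun v : R * R => plus (fst g * fst v + snd g * snd v)
                    (fst k * fst v + snd k * snd v))).
2: intros; unfold plus; simpl; ring.
exact (filterdiff_plus_fct _ _ _ _ Hf Hh).
Qed.

Lemma is_derive_Rpower (a x : R) :
  0 < x -> is_derive (fun y => Rpower y a) x (a * Rpower x (a - 1)).
Proof. intros Hx; apply is_derive_Reals, derivable_pt_lim_power, Hx. Qed.

Lemma filterdiff_curve (c1 c2 : R -> R) (x a b : R) :
  is_derive c1 x a -> is_derive c2 x b ->
  filterdiff (fun y => (c1 y, c2 y)) (locally x) (fun h => (h * a, h * b)).
Proof.
intros H1 H2.
refine (filterdiff_comp_2 c1 c2 (fun a b => (a, b)) _ _ (fun a b => (a, b))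
  H1 H2 _).
apply filterdiff_ext with (f := fun t : R * R => t).
- intros [y z]; reflexivity.
- apply (filterdiff_ext_lin _ (fun t : R * R => t)); [|intros [y z]; reflexivity].
  apply filterdiff_id.
Qed.

(** * The shock function and its derivative *)

Lemma Rpower_gt_1 (k a : R) : 1 < k -> 0 < a -> 1 < Rpower k a.
Proof.
intros Hk Ha; rewrite <- (Rpower_O k) by lra; apply Rpower_lt; assumption.
Qed.

Lemma f_shock_radicand_gt0 (gamma k : R) :
  0 < gamma -> 1 < k -> 0 < (1 - 1 / k) * (Rpower k gamma - 1).
Proof.
intros Hg Hk; apply Rmult_lt_0_compat.
- unfold Rdiv; rewrite Rmult_1_l.
  assert (/ k < 1) by (rewrite <- Rinv_1; apply Rinv_lt_contravar; lra); lra.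
- pose proof (Rpower_gt_1 k gamma Hk Hg); lra.
Qed.

Lemma f_shock_gt0 (gamma k : R) : 0 < gamma -> 1 < k -> 0 < f_shock gamma k.
Proof. intros; apply sqrt_lt_R0, f_shock_radicand_gt0; assumption. Qed.

Definition f_shock' (gamma k : R) : R :=
  (gamma * Rpower k (gamma + 1) + (1 - gamma) * Rpower k gamma - 1)
  / (2 * k ^ 2 * f_shock gamma k).

Lemma is_derive_f_shock (gamma k : R) :
  0 < gamma -> 1 < k -> is_derive (f_shock gamma) k (f_shock' gamma k).
Proof.
intros Hg Hk.
pose proof (f_shock_gt0 gamma k Hg Hk) as Hf.
assert (Hin : is_derive (fun y => (1 - 1 / y) * (Rpower y gamma - 1)) k
  (1 / k ^ 2 * (Rpower k gamma - 1)
   + (1 - 1 / k) * (gamma * Rpower k (gamma - 1)))).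
{ apply (is_derive_mult (fun y => 1 - 1 / y) (fun y => Rpower y gamma - 1)).
  - auto_derive; [lra|field; lra].
  - apply (is_derive_ext (fun y => minus (Rpower y gamma) 1)).
    { intros; reflexivity. }
    replace (gamma * Rpower k (gamma - 1))
      with (minus (gamma * Rpower k (gamma - 1)) 0)
      by (unfold minus, plus, opp; simpl; ring).
    apply (is_derive_minus (K := R_AbsRing) (V := R_NormedModule)).
    + apply is_derive_Rpower; lra.
    + apply (is_derive_const (K := R_AbsRing) (V := R_NormedModule)).
  - exact Rmult_comm. }
replace (f_shock' gamma k) with
  ((1 / k ^ 2 * (Rpower k gamma - 1)
    + (1 - 1 / k) * (gamma * Rpower k (gamma - 1))) / (2 * f_shock gamma k)).
- exact (is_derive_sqrt _ _ _ Hin (f_shock_radicand_gt0 gamma k Hg Hk)).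
- unfold f_shock'.
  replace (Rpower k (gamma + 1)) with (Rpower k gamma * k)
    by (rewrite Rpower_plus, Rpower_1 by lra; ring).
  replace (Rpower k (gamma - 1)) with (Rpower k gamma / k)
    by (unfold Rminus; rewrite Rpower_plus, Rpower_Ropp, Rpower_1 by lra;
        field; lra).
  field; lra.
Qed.

Lemma f_shock'_gt0 (gamma k : R) : 0 < gamma -> 1 < k -> 0 < f_shock' gamma k.
Proof.
intros Hg Hk.
pose proof (f_shock_gt0 gamma k Hg Hk) as Hf.
pose proof (Rpower_gt_1 k gamma Hk Hg) as Hp.
unfold f_shock'; rewrite Rpower_plus, Rpower_1 by lra.
apply Rdiv_lt_0_compat.
(* The numerator is [gamma k^gamma (k - 1) + (k^gamma - 1)], a sum of positive terms. *)
- assert (0 < gamma * Rpower k gamma * (k - 1)); [|nra].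
  repeat apply Rmult_lt_0_compat; lra.
- repeat apply Rmult_lt_0_compat; lra.
Qed.

(** * Gradients at points of the front *)

Lemma grad_is_grad (D : R * R -> Prop) (h : R * R -> R) (p g : R * R) :
  is_grad D h p g -> is_grad D h p (grad D h p).
Proof.
intros Hg; apply (epsilon_spec (inhabits (0, 0)) (is_grad D h p)).
exists g; exact Hg.
Qed.

Lemma front_in_Omega (T : R) (w s : R -> R) (t : R) :
  (forall t, 0 < t < T -> w t < s t) -> 0 < t < T -> Omega T w s (s t, t).
Proof. intros Hws Ht; specialize (Hws t Ht); split; simpl; lra. Qed.

Lemma locally_between (a b t : R) : a < t < b -> locally t (fun x => a < x < b).
Proof.
intros [Ha Hb].
apply filter_and; [exact (open_gt a t Ha)|exact (open_lt b t Hb)].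
Qed.

(** The front lies in the region and has tangent [(s', 1)]. This serves twice: to show that
    gradients are unique, and to differentiate the shock relation in time. *)
Lemma is_grad_front_derive (T : R) (w s : R -> R) (h : R * R -> R)
    (t : R) (g : R * R) :
  (forall t, 0 < t < T -> w t < s t) -> 0 < t < T -> ex_derive s t ->
  is_grad (Omega T w s) h (s t, t) g ->
  is_derive (fun x => h (s x, x)) t (fst g * Derive s t + snd g).
Proof.
intros Hws Ht Hs Hg; unfold is_derive.
apply (filterdiff_ext_lin _
  (fun x : R => x * (fst g * fst (Derive s t, 1) + snd g * snd (Derive s t, 1)))).
- refine (is_grad_along _ h g _ (fun x => (s x, x)) t (locally t) _ _ _ _ Hg).
  + intros P HP; exact HP.
  + generalize (locally_between _ _ _ Ht); apply filter_imp.
    intros x Hx; apply front_in_Omega; assumption.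
  + apply (filterdiff_curve s (fun x => x)).
    * apply Derive_correct, Hs.
    * apply is_derive_Reals, derivable_pt_lim_id.
- intros x; unfold scal; simpl; unfold mult; simpl; ring.
Qed.

(** Since [w t < s t], points just left of the front at time [t] belong to the region, so the
    derivative from the left isolates the [x] component. *)
Lemma is_grad_horizontal (T : R) (w s : R -> R) (h : R * R -> R)
    (t : R) (g : R * R) :
  w t < s t -> 0 < t < T ->
  is_grad (Omega T w s) h (s t, t) g ->
  filterdiff (fun x => h (x, t)) (at_left (s t)) (fun x => x * fst g).
Proof.
intros Hws Ht Hg.
apply (filterdiff_ext_lin _
  (fun x : R => x * (fst g * fst (1, 0) + snd g * snd (1, 0)))).
- refine (is_grad_along _ h g _ (fun x => (x, t)) (s t) (at_left (s t)) _ _ _ _ Hg).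
  + apply within_filter_lim.
  + unfold at_left, within.
    generalize (locally_between (w t) (s t + 1) (s t) (conj Hws (Rlt_plus_1 _))).
    apply filter_imp; intros x Hx1 Hx2; split; simpl; lra.
  + apply (filterdiff_filter_le (U := R_NormedModule)
      (V := prod_NormedModule _ R_NormedModule R_NormedModule)
      (locally (s t)) _ _ _ (s t)).
    * apply at_left_proper_filter.
    * intros P HP; exact HP.
    * apply filter_le_within.
    * apply (filterdiff_curve (fun x => x) (fun _ => t)).
      -- apply is_derive_Reals, derivable_pt_lim_id.
      -- apply is_derive_Reals, derivable_pt_lim_const.
- intros x; simpl; ring.
Qed.

(** The horizontal chord determines the [x] component, and the tangent [(s', 1)] then determines the
    [t] component. This identifies the chosen [grad] with any gradient computed by the product and
    chain rules. *)
Lemma front_grad_eq (T : R) (w s : R -> R) (h : R * R -> R)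
    (t : R) (g : R * R) :
  (forall t, 0 < t < T -> w t < s t) -> 0 < t < T -> ex_derive s t ->
  is_grad (Omega T w s) h (s t, t) g -> grad (Omega T w s) h (s t, t) = g.
Proof.
intros Hws Ht Hs Hg.
pose proof (grad_is_grad _ _ _ _ Hg) as Hg'.
assert (E1 : fst (grad (Omega T w s) h (s t, t)) = fst g).
{ apply (filterdiff_slope_unique (at_left (s t)) (fun x => h (x, t)) (s t)).
  - apply at_left_proper_filter.
  - apply within_filter_lim.
  - unfold at_left, within; apply filter_forall; intros x Hx; lra.
  - apply (is_grad_horizontal T w s); auto.
  - apply (is_grad_horizontal T w s); auto. }
pose proof (is_derive_unique _ _ _
  (is_grad_front_derive _ _ _ _ _ _ Hws Ht Hs Hg)) as D1.
pose proof (is_derive_unique _ _ _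
  (is_grad_front_derive _ _ _ _ _ _ Hws Ht Hs Hg')) as D2.
destruct (grad (Omega T w s) h (s t, t)) as [a b], g as [a' b'].
simpl in *; subst a'; f_equal; lra.
Qed.

(** * The characteristic relation on the front *)

(* With [P = c rho_x] and [Q = rho u_x], the momentum equation and the
   differentiated shock relation give [(a + gc) Q = (c + ga) P], where
   [a = s' - u]; the characteristic derivatives of [c] are multiples of
   [P - Q] and [- P - Q]. *)
Lemma characteristic_relation (rho u c s' F rho_x rho_t u_x u_t : R) :
  0 < rho -> 0 < c -> u < s' -> 0 < F ->
  rho_t + (rho_x * u + rho * u_x) = 0 ->
  rho_t * u + rho * u_t
    + (rho_x * u ^ 2 + 2 * rho * u * u_x + c ^ 2 * rho_x) = 0 ->
  u_x * s' + u_t = F * (rho_x * s' + rho_t) ->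
  (rho_t + (u + c) * rho_x)
  + (c - (s' - u)) / (c + (s' - u)) * ((F * rho / c - 1) / (F * rho / c + 1))
    * (rho_t + (u - c) * rho_x) = 0.
Proof.
intros Hrho Hc Hs HF Hm Hp Hf.
assert (Et : rho_t = - (rho_x * u + rho * u_x)) by lra.
assert (Eu : rho * u_t = - (rho * u * u_x + c ^ 2 * rho_x)) by (subst; nra).
(* This is [rho] times the differentiated shock relation with both time derivatives eliminated; the
   [g] of the relation between [P] and [Q] is [F * rho / c]. *)
assert (Ef : - c ^ 2 * rho_x + rho * u_x * (s' - u)
             = F * rho * (rho_x * (s' - u) - rho * u_x)).
{ subst rho_t; transitivity (rho * (u_x * s' + u_t)); [lra|rewrite Hf; ring]. }
subst rho_t.
assert (0 < F * rho) by (apply Rmult_lt_0_compat; assumption).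
match goal with |- ?l = 0 =>
  (* Over a common denominator, the left side is [2 * c] times the difference of the two sides of
     [Ef]. *)
  replace l with (2 * c * (F * rho * (u_x * rho) * (- 1)
    + rho_x * (c ^ 2 + F * rho * (s' - u)) - rho * u_x * (s' - u))
    / ((c + (s' - u)) * (F * rho + c))) end.
- replace (F * rho * (u_x * rho) * (- 1)
    + rho_x * (c ^ 2 + F * rho * (s' - u)) - rho * u_x * (s' - u))
    with 0 by lra.
  unfold Rdiv; ring.
- field; repeat split; lra.
Qed.

Lemma Rpower_half_sqr (x a : R) : Rpower x (a / 2) ^ 2 = Rpower x a.
Proof. simpl; rewrite Rmult_1_r, <- Rpower_plus; f_equal; field. Qed.

Lemma Rpower_pred (x a : R) : 0 < x -> x * Rpower x (a - 1) = Rpower x a.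
Proof.
intros Hx; rewrite <- (Rpower_1 x) at 1 by assumption.
rewrite <- Rpower_plus; f_equal; ring.
Qed.

(** Conservation of mass gives [s' = k u / (k - 1)]. Inserted in the momentum condition, this leaves
    [k rho_inf u^2 / (k - 1) = rho^gamma - rho_inf^gamma], and [u > 0] selects the positive root. *)
Lemma front_velocity (gamma rho_inf rho u s' : R) :
  0 < gamma -> 0 < rho_inf < rho -> 0 < u ->
  (rho - rho_inf) * s' = rho * u ->
  rho * u * s' = rho * u ^ 2 + Rpower rho gamma - Rpower rho_inf gamma ->
  u = Rpower rho_inf ((gamma - 1) / 2) * f_shock gamma (rho / rho_inf).
Proof.
intros Hg Hr Hu Hmass Hmom.
set (k := rho / rho_inf).
assert (Erho : rho = k * rho_inf) by (unfold k; field; lra).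
assert (Hk : 1 < k).
{ unfold k; apply (Rmult_lt_reg_r rho_inf); [lra|field_simplify; lra]. }
set (e := Rpower rho_inf ((gamma - 1) / 2)).
assert (He : 0 < e) by apply exp_pos.
assert (Ee : Rpower rho_inf gamma = rho_inf * e ^ 2).
{ unfold e; rewrite Rpower_half_sqr, Rpower_pred; lra. }
assert (Ek : Rpower rho gamma = Rpower k gamma * (rho_inf * e ^ 2)).
{ rewrite <- Ee, Erho, Rpower_mult_distr; lra. }
rewrite Ek, Ee in Hmom.
assert (Es : s' = k * u / (k - 1)).
{ apply (Rmult_eq_reg_l (rho - rho_inf)); [|lra].
  rewrite Hmass, Erho; field; lra. }
assert (Hu2 : u ^ 2 = e ^ 2 * ((1 - 1 / k) * (Rpower k gamma - 1))).
{ apply (Rmult_eq_reg_l (k * rho_inf / (k - 1))).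
  - transitivity (rho * u * s' - rho * u ^ 2).
    + rewrite Es, Erho; field; lra.
    + rewrite Hmom; field; lra.
  - assert (0 < k * rho_inf / (k - 1)); [|lra].
    apply Rdiv_lt_0_compat; [apply Rmult_lt_0_compat|]; lra. }
unfold f_shock.
rewrite <- (sqrt_pow2 u), Hu2 by lra.
rewrite sqrt_mult.
- rewrite sqrt_pow2; lra.
- apply pow2_ge_0.
- left; apply f_shock_radicand_gt0; assumption.
Qed.

Lemma characteristic_relation_front (gamma rho_inf T : R) (w s : R -> R)
    (rho u : R * R -> R) (t : R) :
  1 < gamma -> 0 < rho_inf -> piston_solution gamma rho_inf T w s rho u ->
  0 < t < T ->
  d_plus gamma (Omega T w s) rho u (sound_speed gamma rho) (s t, t)
  + k_g gamma (front_ratio rho_inf s rho t)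
    * d_minus gamma (Omega T w s) rho u (sound_speed gamma rho) (s t, t) = 0.
Proof.
intros Hgam Hinf HS Ht.
pose proof (ps_w_lt_s _ _ _ _ _ _ _ HS) as Hws.
pose proof (ps_s_derive _ _ _ _ _ _ _ HS t Ht) as Hsd.
set (D := Omega T w s); set (p := (s t, t)).
assert (Dp : D p) by (apply front_in_Omega; assumption).
(* Every [Dt] and [Dx] in the Euler equations and in the goal can now be replaced by its value from
   the calculus rules. *)
assert (Heq : forall h g, is_grad D h p g -> grad D h p = g)
  by (intros; apply front_grad_eq; assumption).
pose proof (ps_rho_gt0 _ _ _ _ _ _ _ HS p Dp) as Hrho.
destruct (proj1 (ps_rho_C1 _ _ _ _ _ _ _ HS) p Dp) as [[rx rt] Gr].
destruct (proj1 (ps_u_C1 _ _ _ _ _ _ _ HS) p Dp) as [[ux ut] Gu].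
pose proof (is_grad_mult _ _ _ _ _ _ Dp Gr Gu) as Gru.
assert (Gu2 : is_grad D (fun q => u q ^ 2) p (2 * u p * ux, 2 * u p * ut)).
{ apply (is_grad_comp D u p (ux, ut) (fun x => x ^ 2)); try assumption.
  auto_derive; [exact I|ring]. }
pose proof (is_grad_mult _ _ _ _ _ _ Dp Gr Gu2) as Gru2.
pose proof (is_grad_comp _ _ _ _ _ _ Dp Gr (is_derive_Rpower gamma _ Hrho)) as Gp.
pose proof (is_grad_plus _ _ _ _ _ _ Gru2 Gp) as Gm.
assert (Gc : is_grad D (sound_speed gamma rho) p
   (sqrt gamma * ((gamma - 1) / 2 * Rpower (rho p) ((gamma - 1) / 2 - 1)) * rx,
    sqrt gamma * ((gamma - 1) / 2 * Rpower (rho p) ((gamma - 1) / 2 - 1)) * rt)).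
{ apply (is_grad_comp D rho p (rx, rt)
    (fun x => sqrt gamma * Rpower x ((gamma - 1) / 2))); try assumption.
  apply is_derive_scal, is_derive_Rpower, Hrho. }
pose proof (ps_mass _ _ _ _ _ _ _ HS p Dp) as Hmass.
pose proof (ps_momentum _ _ _ _ _ _ _ HS p Dp) as Hmom.
fold D in Hmass, Hmom.
unfold Dt, Defs.Dx in Hmass, Hmom.
rewrite (Heq _ _ Gr), (Heq _ _ Gru) in Hmass.
rewrite (Heq _ _ Gru), (Heq _ _ Gm) in Hmom.
cbn [fst snd] in Hmass, Hmom.
unfold d_plus, d_minus, Dt, Defs.Dx, lambda_plus, lambda_minus.
rewrite (Heq _ _ Gc); cbn [fst snd].
pose proof (is_grad_front_derive _ _ _ _ _ _ Hws Ht Hsd Gr) as Dr.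
pose proof (is_grad_front_derive _ _ _ _ _ _ Hws Ht Hsd Gu) as Du.
cbn [fst snd] in Dr, Du.
pose proof (ps_entropy _ _ _ _ _ _ _ HS t Ht) as Hent.
pose proof (ps_u_gt0 _ _ _ _ _ _ _ HS t Ht) as Hu.
pose proof (ps_RH_mass _ _ _ _ _ _ _ HS t Ht) as HRH.
(* The velocity formula is needed at all times in [(0, T)], since it is differentiated in [t]
   next. *)
assert (Hvel : forall t, 0 < t < T -> u (s t, t) =
  Rpower rho_inf ((gamma - 1) / 2) * f_shock gamma (front_ratio rho_inf s rho t)).
{ intros x Hx; apply (front_velocity gamma rho_inf _ _ (Derive s x)).
  - lra.
  - split; [assumption|exact (ps_entropy _ _ _ _ _ _ _ HS x Hx)].
  - exact (ps_u_gt0 _ _ _ _ _ _ _ HS x Hx).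
  - exact (ps_RH_mass _ _ _ _ _ _ _ HS x Hx).
  - exact (ps_RH_momentum _ _ _ _ _ _ _ HS x Hx). }
fold p in Hent, Hu, HRH.
set (k := front_ratio rho_inf s rho t) in *.
assert (Erho : rho p = k * rho_inf)
  by (unfold k, front_ratio; fold p; field; lra).
assert (Hk : 1 < k).
{ apply (Rmult_lt_reg_r rho_inf); lra. }
set (e := Rpower rho_inf ((gamma - 1) / 2)) in *.
assert (He : 0 < e) by apply exp_pos.
pose proof (f_shock_gt0 gamma k ltac:(lra) Hk) as Hf.
pose proof (f_shock'_gt0 gamma k ltac:(lra) Hk) as Hf'.
pose proof (is_derive_f_shock gamma k ltac:(lra) Hk) as Df.
(* The factor [e * f'(k) / rho_inf] is [du / d rho] along the shock curve; it plays the part of [F]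
   in [characteristic_relation]. *)
assert (Hshock : ux * Derive s t + ut =
  e * f_shock' gamma k / rho_inf * (rx * Derive s t + rt)).
{ rewrite <- (is_derive_unique _ _ _ Du).
  apply is_derive_unique.
  apply (is_derive_ext_loc
    (fun x => e * f_shock gamma (rho (s x, x) * / rho_inf))).
  { generalize (locally_between _ _ _ Ht); apply filter_imp.
    intros x Hx; symmetry; exact (Hvel x Hx). }
  replace (e * f_shock' gamma k / rho_inf * (rx * Derive s t + rt))
    with (e * ((rx * Derive s t + rt) * / rho_inf * f_shock' gamma k))
    by (field; lra).
  apply is_derive_scal.
  apply (is_derive_comp (f_shock gamma) (fun x => rho (s x, x) * / rho_inf)).
  - exact Df.
  - exact (is_derive_scal_l (K := R_AbsRing) (V := R_NormedModule) _ _ _ (/ rho_inf) Dr). }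
unfold k_g.
rewrite (is_derive_unique _ _ _ Df).
set (C := Rpower k ((gamma - 1) / 2)).
assert (HC : 0 < C) by apply exp_pos.
assert (Hsg : 0 < sqrt gamma) by (apply sqrt_lt_R0; lra).
assert (EC : Rpower k ((3 - gamma) / 2) = k / C).
{ unfold C, Rdiv at 2; rewrite <- Rpower_Ropp.
  rewrite <- (Rpower_1 k) at 2 by lra.
  rewrite <- Rpower_plus; f_equal; field. }
assert (Ec : sound_speed gamma rho p = sqrt gamma * (C * e)).
{ unfold sound_speed, C, e; rewrite Rpower_mult_distr by lra.
  rewrite <- Erho; reflexivity. }
assert (Eu : u p = e * f_shock gamma k) by exact (Hvel t Ht).
assert (Es : Derive s t = k * u p / (k - 1)).
{ apply (Rmult_eq_reg_l (rho p - rho_inf)); [|lra].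
  rewrite HRH, Erho; field; lra. }
assert (Esu : Derive s t - u p = u p / (k - 1)) by (rewrite Es; field; lra).
(* The derivative of the pressure with respect to density is the square of the sound speed. *)
assert (Ec2 : gamma * Rpower (rho p) (gamma - 1) = sound_speed gamma rho p ^ 2).
{ unfold sound_speed.
  rewrite Rpow_mult_distr, Rpower_half_sqr, pow2_sqrt; lra. }
rewrite Ec2 in Hmom.
assert (Hc : 0 < sound_speed gamma rho p)
  by (rewrite Ec; repeat apply Rmult_lt_0_compat; assumption).
assert (0 < u p / (k - 1)) by (apply Rdiv_lt_0_compat; lra).
assert (HF : 0 < e * f_shock' gamma k / rho_inf).
{ apply Rdiv_lt_0_compat; [apply Rmult_lt_0_compat|]; assumption. }
assert (Hus : u p < Derive s t) by lra.
replace (rx * u p ^ 2 + rho p * (2 * u p * ux))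
  with (rx * u p ^ 2 + 2 * rho p * u p * ux) in Hmom by ring.
pose proof (characteristic_relation _ _ _ _ _ rx rt ux ut Hrho Hc
  Hus HF Hmass Hmom Hshock) as HR.
rewrite Esu in HR.
(* Numerator and denominator are scaled by [e / (k - 1)], using [c = sqrt gamma * C * e] and
   [u = e * f(k)]. *)
replace ((sqrt gamma * (k - 1) * C - f_shock gamma k)
          / (f_shock gamma k + sqrt gamma * (k - 1) * C))
  with ((sound_speed gamma rho p - u p / (k - 1))
        / (sound_speed gamma rho p + u p / (k - 1))).
2: { rewrite Ec, Eu; field; repeat split; try lra.
     all: assert (0 < sqrt gamma * (k - 1) * C)
       by (repeat apply Rmult_lt_0_compat; lra); nra. }
replace (1 / sqrt gamma * f_shock' gamma k * Rpower k ((3 - gamma) / 2))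
  with (e * f_shock' gamma k / rho_inf * rho p / sound_speed gamma rho p).
2: { rewrite Ec, EC, Erho; field; repeat split; lra. }
(* [kappa] is [dc / d rho], so the goal is [kappa] times the relation [HR] for [rho]. *)
set (kappa := sqrt gamma * _).
transitivity (kappa * 0); [rewrite <- HR|]; ring.
Qed.

(** * Asymptotics of [1 - k_g] for strong shocks *)

(** Uniformity comes for free: the threshold beyond which [h] is close to [l] does not depend on
    [a]. The asymptotics thus reduce to limits in the single variable [k]. *)
Lemma unif_lim_comp {A : Type} (D : R -> A -> Prop) (K : R -> A -> R)
    (h : R -> R) (l : R) :
  unif_lim_p_infty D K -> is_lim h p_infty l ->
  unif_lim D (fun r a => h (K r a)) l.
Proof.
intros HK Hh eps.
destruct (proj2 (is_lim_spec h p_infty l) Hh eps) as [M HM].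
generalize (HK M); apply filter_imp; intros r Hr a Ha; apply HM, Hr, Ha.
Qed.

Lemma is_lim_Rpower_neg (a : R) :
  0 < a -> is_lim (fun k => Rpower k (- a)) p_infty 0.
Proof.
intros Ha; unfold Rpower.
apply (is_lim_comp exp (fun k => - a * ln k) p_infty 0 m_infty).
- exact is_lim_exp_m.
- replace m_infty with (Rbar_mult (- a) p_infty).
  + apply is_lim_scal_l, is_lim_ln_p.
  + rewrite Rbar_mult_comm; apply is_Rbar_mult_unique.
    apply is_Rbar_mult_p_infty_neg; simpl; lra.
- exists 0; intros; discriminate.
Qed.

Lemma is_lim_mult_finite (f g : R -> R) (x : Rbar) (a b : R) :
  is_lim f x a -> is_lim g x b -> is_lim (fun y => f y * g y) x (a * b).
Proof. intros Hf Hg; exact (is_lim_mult f g x a b Hf Hg I). Qed.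

Lemma is_lim_div_finite (f g : R -> R) (x : Rbar) (a b : R) :
  is_lim f x a -> is_lim g x b -> b <> 0 ->
  is_lim (fun y => f y / g y) x (a / b).
Proof.
intros Hf Hg Hb.
refine (is_lim_div f g x a b Hf Hg _ I).
intros E; apply Hb; injection E; auto.
Qed.

(** Here [k_g] is [(X - f) / (f + X)] times [(g - 1) / (g + 1)]. In [1 - k_g] the mixed terms cancel
    and only positive ones remain, so the same formula yields the sign and the limit. *)
Lemma one_minus_k_g (gamma k : R) :
  1 < gamma -> 1 < k ->
  let X := sqrt gamma * (k - 1) * Rpower k ((gamma - 1) / 2) in
  let g := 1 / sqrt gamma * f_shock' gamma k * Rpower k ((3 - gamma) / 2) in
  0 < X /\ 0 < g /\
  1 - k_g gamma k
    = 2 * (f_shock gamma k * g + X) / ((f_shock gamma k + X) * (g + 1)).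
Proof.
intros Hgam Hk X g.
pose proof (f_shock_gt0 gamma k ltac:(lra) Hk) as Hf.
pose proof (f_shock'_gt0 gamma k ltac:(lra) Hk) as Hf'.
assert (Hsg : 0 < sqrt gamma) by (apply sqrt_lt_R0; lra).
assert (HX : 0 < X).
{ repeat apply Rmult_lt_0_compat; try lra; apply exp_pos. }
assert (Hg : 0 < g).
{ apply Rmult_lt_0_compat; [|apply exp_pos].
  apply Rmult_lt_0_compat; [|exact Hf'].
  apply Rdiv_lt_0_compat; lra. }
split; [exact HX|split; [exact Hg|]].
unfold k_g.
rewrite (is_derive_unique _ _ _ (is_derive_f_shock gamma k ltac:(lra) Hk)).
fold X g; field; lra.
Qed.

Lemma one_minus_k_g_gt0 (gamma k : R) :
  1 < gamma -> 1 < k -> 0 < 1 - k_g gamma k.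
Proof.
intros Hgam Hk.
destruct (one_minus_k_g gamma k Hgam Hk) as [HX [Hg E]].
pose proof (f_shock_gt0 gamma k ltac:(lra) Hk) as Hf.
rewrite E; apply Rdiv_lt_0_compat.
- apply Rmult_lt_0_compat; [lra|].
  apply Rplus_lt_0_compat; [apply Rmult_lt_0_compat|]; assumption.
- apply Rmult_lt_0_compat; lra.
Qed.

(* The factors of [k_g] are [(1 - a) / (1 + a)] and [(1 - b) / (1 + b)] with
   [a = shock_A gamma k * k^(-1/2)] and [b = shock_B gamma k * k^(-1/2)]. *)
Definition shock_A (gamma k : R) : R :=
  sqrt ((1 - / k) * (1 - Rpower k (- gamma))) / (sqrt gamma * (1 - / k)).

Definition shock_B (gamma k : R) : R :=
  2 * sqrt gamma * sqrt ((1 - / k) * (1 - Rpower k (- gamma)))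
  / (gamma + (1 - gamma) * / k - Rpower k (- gamma) * / k).

(** Dividing numerator and denominator of [one_minus_k_g] by [X * g] gives
    [2 (a + b) / ((1 + a) (1 + b))] with [a = f / X] and [b = 1 / g]. The factor [k^(-1/2)] of
    [a + b] cancels, and [2 / (6 / sqrt gamma)] is [sqrt gamma / 3]. *)
Lemma k_g_ratio (gamma k : R) :
  1 < gamma -> 1 < k ->
  (1 - k_g gamma k) / (6 / sqrt gamma * Rpower k (- (1 / 2)))
  = sqrt gamma / 3 * (shock_A gamma k + shock_B gamma k)
    / ((1 + shock_A gamma k * Rpower k (- (1 / 2)))
       * (1 + shock_B gamma k * Rpower k (- (1 / 2)))).
Proof.
intros Hgam Hk.
destruct (one_minus_k_g gamma k Hgam Hk) as [HX [Hg E]].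
rewrite E; clear E.
pose proof (f_shock_gt0 gamma k ltac:(lra) Hk) as Hf.
assert (Hsg : 0 < sqrt gamma) by (apply sqrt_lt_R0; lra).
assert (Esg : gamma = sqrt gamma * sqrt gamma) by (symmetry; apply sqrt_def; lra).
set (X := sqrt gamma * (k - 1) * _) in *.
set (g := 1 / sqrt gamma * _ * _) in *.
set (r := Rpower k (- (1 / 2))).
assert (Hr : 0 < r) by apply exp_pos.
(* All powers of [k] involved are rational in [h], [v] and [k], which turns the identities into work
   for [field]. *)
pose (h := Rpower k (1 / 2)); pose (v := Rpower k (gamma / 2)).
assert (Hh : 0 < h) by apply exp_pos.
assert (Hv : 0 < v) by apply exp_pos.
assert (Ek : k = h ^ 2).
{ unfold h; rewrite Rpower_half_sqr, Rpower_1; lra. }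
assert (Ev : Rpower k gamma = v ^ 2) by (unfold v; rewrite Rpower_half_sqr; auto).
assert (Er : r = / h) by apply Rpower_Ropp.
assert (Ep : Rpower k (- gamma) = / v ^ 2) by (rewrite Rpower_Ropp, Ev; auto).
assert (E1 : Rpower k ((gamma - 1) / 2) = v * / h).
{ unfold v, h; rewrite <- Rpower_Ropp, <- Rpower_plus; f_equal; field. }
assert (E2 : Rpower k ((3 - gamma) / 2) = k * h * / v).
{ unfold v, h; rewrite <- Rpower_Ropp.
  rewrite <- (Rpower_1 k) at 2 by lra.
  rewrite <- !Rpower_plus; f_equal; field. }
assert (E3 : Rpower k (gamma + 1) = v ^ 2 * k).
{ rewrite Rpower_plus, Ev, Rpower_1; lra. }
assert (Hv1 : 1 < v ^ 2) by (rewrite <- Ev; apply Rpower_gt_1; lra).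
assert (Hk1 : / k < 1) by (rewrite <- Rinv_1; apply Rinv_lt_contravar; lra).
assert (ES : sqrt ((1 - / k) * (1 - Rpower k (- gamma))) = f_shock gamma k * / v).
{ unfold f_shock; rewrite Ep.
  replace ((1 - 1 / k) * (Rpower k gamma - 1))
    with ((1 - / k) * (1 - / v ^ 2) * v ^ 2) by (rewrite Ev; field; lra).
  rewrite (sqrt_mult_alt ((1 - / k) * (1 - / v ^ 2))), sqrt_pow2; try lra.
  - field; lra.
  - assert (/ v ^ 2 < 1) by (rewrite <- Rinv_1; apply Rinv_lt_contravar; lra).
    left; apply Rmult_lt_0_compat; lra. }
assert (HM : 0 < gamma * v ^ 2 * k + (1 - gamma) * v ^ 2 - 1).
{ assert (0 < gamma * v ^ 2 * (k - 1)); [|lra].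
  repeat apply Rmult_lt_0_compat; lra. }
assert (Ea : shock_A gamma k = f_shock gamma k / (r * X)).
{ unfold shock_A, X; rewrite ES, Er, E1.
  generalize (f_shock gamma k); intros F.
  clearbody h v; clear - Ek Hk Hsg Hh Hv.
  subst k; field; repeat split; try lra; nra. }
assert (Eb : shock_B gamma k = / (r * g)).
{ unfold shock_B, g, f_shock'; rewrite ES, Er, E2, E3, Ep, Ev.
  field; repeat split; try lra. }
rewrite Ea, Eb; field; repeat split; lra.
Qed.

(** [shock_A] tends to [1 / sqrt gamma] and [shock_B] to [2 / sqrt gamma]; their sum
    [3 / sqrt gamma] accounts for the constant 6, while both factors of the denominator tend to
    1. *)
Lemma is_lim_k_g_ratio (gamma : R) :
  1 < gamma ->
  is_lim (fun k => (1 - k_g gamma k) / (6 / sqrt gamma * Rpower k (- (1 / 2))))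
    p_infty 1.
Proof.
intros Hgam.
assert (Hsg : 0 < sqrt gamma) by (apply sqrt_lt_R0; lra).
assert (Esg : gamma = sqrt gamma * sqrt gamma) by (symmetry; apply sqrt_def; lra).
pose proof (is_lim_Rpower_neg (1 / 2) ltac:(lra)) as Lr.
pose proof (is_lim_Rpower_neg gamma ltac:(lra)) as Lp.
assert (Lq : is_lim (fun k => / k) p_infty 0).
{ apply (is_lim_inv (fun k => k) p_infty p_infty); [apply is_lim_id|discriminate]. }
assert (Lc : forall c, is_lim (fun _ => c) p_infty c) by (intros; apply is_lim_const).
assert (L1q := is_lim_minus' _ _ _ _ _ (Lc 1) Lq).
assert (LS := is_lim_comp_continuous _ sqrt _ _
  (is_lim_mult_finite _ _ _ _ _ L1q (is_lim_minus' _ _ _ _ _ (Lc 1) Lp))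
  (continuous_sqrt _)).
assert (LA := is_lim_div_finite _ _ _ _ _ LS
  (is_lim_mult_finite _ _ _ _ _ (Lc (sqrt gamma)) L1q)).
specialize (LA ltac:(lra)).
assert (LB := is_lim_div_finite _ _ _ _ _
  (is_lim_mult_finite _ _ _ _ _ (Lc (2 * sqrt gamma)) LS)
  (is_lim_minus' _ _ _ _ _
    (is_lim_plus' _ _ _ _ _ (Lc gamma)
      (is_lim_mult_finite _ _ _ _ _ (Lc (1 - gamma)) Lq))
    (is_lim_mult_finite _ _ _ _ _ Lp Lq))).
specialize (LB ltac:(lra)).
assert (L := is_lim_div_finite _ _ _ _ _
  (is_lim_mult_finite _ _ _ _ _ (Lc (sqrt gamma / 3))
    (is_lim_plus' _ _ _ _ _ LA LB))
  (is_lim_mult_finite _ _ _ _ _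
    (is_lim_plus' _ _ _ _ _ (Lc 1) (is_lim_mult_finite _ _ _ _ _ LA Lr))
    (is_lim_plus' _ _ _ _ _ (Lc 1) (is_lim_mult_finite _ _ _ _ _ LB Lr)))).
specialize (L ltac:(lra)).
match type of L with is_lim _ _ (Finite ?l) => replace l with 1 in L end.
- apply (is_lim_ext_loc) with (2 := L).
  exists 1; intros k Hk; symmetry; apply (k_g_ratio gamma k Hgam Hk).
- replace ((1 - 0) * (1 - 0)) with 1 by ring; rewrite sqrt_1.
  replace (gamma + (1 - gamma) * 0 - 0 * 0) with (sqrt gamma * sqrt gamma) by lra.
  field; lra.
Qed.

Lemma one_minus_k_g_asymp {A : Type} (gamma : R) (D : R -> A -> Prop)
    (K : R -> A -> R) :
  1 < gamma -> unif_lim_p_infty D K ->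
  asymp_equiv D (fun r a => 1 - k_g gamma (K r a))
    (fun r a => 6 / sqrt gamma * Rpower (K r a) (- (1 / 2))).
Proof.
intros Hgam HK.
assert (Hsg : 0 < sqrt gamma) by (apply sqrt_lt_R0; lra).
assert (HG : forall k, 0 < 6 / sqrt gamma * Rpower k (- (1 / 2))).
{ intros k; apply Rmult_lt_0_compat; [apply Rdiv_lt_0_compat; lra|apply exp_pos]. }
pose proof (is_lim_k_g_ratio gamma Hgam) as LH.
assert (LG : is_lim (fun k => 6 / sqrt gamma * Rpower k (- (1 / 2))) p_infty 0).
{ replace 0 with (6 / sqrt gamma * 0) by ring.
  apply is_lim_mult_finite; [apply is_lim_const|apply is_lim_Rpower_neg; lra]. }
assert (LF : is_lim (fun k => 1 - k_g gamma k) p_infty 0).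
(* [1 - k_g] is the ratio, which tends to 1, times the equivalent, which tends to 0. *)
{ replace 0 with (1 * 0) by ring.
  apply is_lim_ext with (2 := is_lim_mult_finite _ _ _ _ _ LH LG).
  intros k; specialize (HG k); field; split; try lra.
  apply Rgt_not_eq, exp_pos. }
split; [|repeat split].
(* The threshold 1 gives [k > 1], the range in which [1 - k_g] is known to be positive. *)
- generalize (HK 1); apply filter_imp; intros r Hr a Ha; split.
  + apply one_minus_k_g_gt0; [exact Hgam|exact (Hr a Ha)].
  + apply HG.
- exact (unif_lim_comp D K _ _ HK LF).
- exact (unif_lim_comp D K _ _ HK LG).
- exact (unif_lim_comp D K _ _ HK LH).
Qed.

Theorem theorem3p2 (gamma : R) (hgamma : 1 < gamma < 3) :
  (forall (rho_inf T : R) (w s : R -> R) (rho u : R * R -> R),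
      0 < rho_inf -> 0 < T ->
      piston_solution gamma rho_inf T w s rho u ->
      forall t : R, 0 < t < T ->
        d_plus gamma (Omega T w s) rho u (sound_speed gamma rho) (s t, t)
        + k_g gamma (front_ratio rho_inf s rho t)
          * d_minus gamma (Omega T w s) rho u (sound_speed gamma rho) (s t, t)
        = 0)
  /\
  (forall k : R, 1 < k ->
      is_derive (f_shock gamma) k
        ((gamma * Rpower k (gamma + 1) + (1 - gamma) * Rpower k gamma - 1)
         / (2 * k ^ 2 * f_shock gamma k)))
  /\
  (forall (T : R -> R) (w s : R -> R -> R) (rho u : R -> R * R -> R),
      at_right 0 (fun r => 0 < T r /\
        piston_solution gamma r (T r) (w r) (s r) (rho r) (u r)) ->
      unif_lim_p_infty (fun r t => 0 < t < T r)
        (fun r t => front_ratio r (s r) (rho r) t) ->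
      asymp_equiv (fun r t => 0 < t < T r)
        (fun r t => 1 - k_g gamma (front_ratio r (s r) (rho r) t))
        (fun r t => 6 / sqrt gamma
                    * Rpower (front_ratio r (s r) (rho r) t) (- (1 / 2)))).
Proof.
split; [|split].
- intros rho_inf T w s rho u Hinf _ HS t Ht.
  apply characteristic_relation_front; [lra|assumption..].
- intros k Hk; apply is_derive_f_shock; lra.
- intros T w s rho u _ HK.
  apply one_minus_k_g_asymp; [lra|exact HK].
Qed.
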